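(* Let $(\mathbb{F},\star)$ be a Catalan normed magma with generator $\varepsilon$ and norm $\|\cdot\|$ with $\|\varepsilon\|=1$, and let $\mathbb{F}_n=\{u\in\mathbb{F}:\|u\|=n\}$ be the subset of elements of norm $n$. Then the number $N_{n,k}$ of elements of $\mathbb{F}_n$ whose decomposition has exactly $k$ right multiplications by the generator is given by the Narayana distribution $$N_{n,k}=\frac{1}{n-1}\binom{n-1}{k}\binom{n-1}{k-1},\qquad 1\le k\le n-1.$$
   Context: Here $\mathbb{N}=\{1,2,3,\dots\}$. A magma $(\mathbb{F},\star)$ is a non-empty countable set $\mathbb{F}$ together with a map $\star:\mathbb{F}\times\mathbb{F}\to\mathbb{F}$ (no further conditions). A magma morphism is a map between magmas preserving the products. A magma $(\mathbb{F},\star)$ is free if there exist a set $\mathcal{Y}$ and a map $i:\mathcal{Y}\to\mathbb{F}$ such that for every magma $(\mathcal{N},\bullet)$ and every map $f:\mathcal{Y}\to\mathcal{N}$ there is a unique magma morphism $\theta:\mathbb{F}\to\mathcal{N}$ with $f=\theta\circ i$; the elements of $i(\mathcal{Y})$ are the generators. An element is irreducible if it is not in the range of $\star$. A norm is a map $\|\cdot\|:\mathbb{F}\to\mathbb{N}$ with $\|u\star v\|\ge\|u\|+\|v\|$ for all $u,v$; it is additive if equality always holds. A Catalan normed magma is a normed magma that is free, whose norm is additive, and which has exactly one irreducible element, the generator $\varepsilon$ (whose norm is by convention $1$). The decomposition of an element $u\in\mathbb{F}$ is its (unique) expression as a fully bracketed product of copies of $\varepsilon$. The number of right multiplications by the generator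 in the decomposition of $u$ is the number of occurrences of $\star$ in this expression whose right-hand factor is the single generator $\varepsilon$. For example $\varepsilon\star(\varepsilon\star(\varepsilon\star\varepsilon))$ has $1$, $(\varepsilon\star\varepsilon)\star(\varepsilon\star\varepsilon)$ has $2$ and $((\varepsilon\star\varepsilon)\star\varepsilon)\star\varepsilon$ has $3$ right multiplications by the generator. *)

(* Defs.v *)
From mathcomp Require Import all_boot.
From mathcomp Require Import boolp classical_sets functions cardinality.

Set Implicit Arguments.
Unset Strict Implicit.
Unset Printing Implicit Defensive.

Local Open Scope classical_set_scope.

Record magma := MkMagma {
  carrier :> Type;
  star : carrier -> carrier -> carrier;
  magma_nonempty : [set: carrier] !=set0;
  magma_countable : countable [set: carrier] }.

Definition magma_morphism (M N : magma) (theta : M -> N) : Prop :=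
  forall u v : M, theta (star u v) = star (theta u) (theta v).

Definition free_on (M : magma) (Y : Type) (i : Y -> M) : Prop :=
  forall (N : magma) (f : Y -> N),
    exists! theta : M -> N, magma_morphism theta /\ f = theta \o i.

Definition is_free (M : magma) : Prop :=
  exists (Y : Type) (i : Y -> M), free_on i.

Definition irreducible (M : magma) (u : M) : Prop :=
  ~ exists v w : M, u = star v w.

(* Norms take values in {1, 2, 3, ...}, hence the positivity clause. *)
Definition is_norm (M : magma) (norm : M -> nat) : Prop :=
  (forall u, 0 < norm u) /\
  (forall u v, norm u + norm v <= norm (star u v)).

Definition additive_norm (M : magma) (norm : M -> nat) : Prop :=
  forall u v, norm (star u v) = norm u + norm v.

Record catalan_normed_magma (F : magma) (norm : F -> nat) (eps : F) : Prop :=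
  CatalanNormedMagma {
    catalan_norm : is_norm norm;
    catalan_free : is_free F;
    catalan_additive : additive_norm norm;
    catalan_irreducible : forall u : F, irreducible u <-> u = eps;
    catalan_norm_eps : norm eps = 1 }.

(* Fully bracketed products of copies of a single symbol. *)
Inductive bracketing : Type :=
  | Gen
  | Prod of bracketing & bracketing.

Fixpoint eval (M : magma) (eps : M) (t : bracketing) : M :=
  match t with
  | Gen => eps
  | Prod l r => star (eval eps l) (eval eps r)
  end.

Definition is_gen (t : bracketing) : bool :=
  if t is Gen then true else false.

Fixpoint right_mults (t : bracketing) : nat :=
  match t with
  | Gen => 0
  | Prod l r => right_mults l + right_mults r + is_gen r
  end.

(* In a Catalan normed magma with generator eps, each u has exactly one such t. *)
Definition decomposition (M : magma) (eps u : M) (t : bracketing) : Prop :=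
  eval eps t = u.

Definition norm_level (M : magma) (norm : M -> nat) (n : nat) : set M :=
  [set u | norm u = n].

Definition level_right_mults (M : magma) (norm : M -> nat) (eps : M) (n k : nat) :
    set M :=
  [set u | norm_level norm n u /\
           exists t, decomposition eps u t /\ right_mults t = k].

(* Main.v *)
(* Record a product of n generators as a binary tree with n leaves, and let
   F(j,n,k) count the lists of j trees with n leaves and k right
   multiplications by the generator in total.  Splitting the first tree of such
   a list, and pushing the right factor on top of the left one, gives, with G
   counting the lists whose first tree is a product,
     F(j,n,k) = F(j-1,n-1,k) + G(j,n,k),
     G(j,n,k) = F(j,n-1,k-1) + G(j+1,n,k),
   according to whether the first tree, respectively its right factor, is the
   generator.  For j < n the solution is F(j,n,k) = j/n C(n,k) C(n-j-1,k-1),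
   and j = 1 is the Narayana number. *)
Require Import Defs.
From HB Require Import structures.
From mathcomp Require Import all_boot all_order all_algebra.
From mathcomp Require Import finmap zify ring.
From mathcomp Require Import boolp classical_sets functions cardinality.
Import GRing.Theory Num.Theory.

Local Open Scope classical_set_scope.
Local Open Scope card_scope.
Local Open Scope ring_scope.

(** * Countability of bracketings and finite cardinalities *)

Fixpoint tree_of_bracketing (t : bracketing) : GenTree.tree unit :=
  if t is Prod l r
  then GenTree.Node 0 [:: tree_of_bracketing l; tree_of_bracketing r]
  else GenTree.Leaf tt.

Fixpoint bracketing_of_tree (t : GenTree.tree unit) : bracketing :=
  if t is GenTree.Node _ [:: l; r]
  then Prod (bracketing_of_tree l) (bracketing_of_tree r)
  else Gen.

Lemma tree_of_bracketingK : cancel tree_of_bracketing bracketing_of_tree.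
Proof. by elim=> //= l -> r ->. Qed.

HB.instance Definition _ := Countable.copy bracketing (can_type tree_of_bracketingK).

(** The cardinal is stated as a rational because the closed formula [num_forests] involves a
    quotient. *)
Definition has_card {T : Type} (A : set T) (q : rat) : Prop :=
  exists N : nat, A #= `I_N /\ N%:R = q.

Lemma has_card_set0 (T : Type) : has_card (set0 : set T) 0.
Proof. by exists 0%N; split; rewrite ?II0 ?card_eqxx. Qed.

Lemma has_card_set1 (T : Type) (x : T) : has_card [set x] 1.
Proof. by exists 1%N; split=> //; apply: card_set1. Qed.

Lemma has_card_image (T U : Type) (A : set T) (f : T -> U) (q : rat) :
  {in A &, injective f} -> has_card A q -> has_card (f @` A) q.
Proof.
move=> f_inj [N [cA <-]]; exists N; split=> //.
by rewrite (card_eql (inj_card_eq f_inj)).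
Qed.

Lemma has_card_setU (T : choiceType) (A B : set T) (p q : rat) :
  A `&` B = set0 -> has_card A p -> has_card B q ->
  has_card (A `|` B) (p + q).
Proof.
move=> AB0 [a [cA <-]] [b [cB <-]]; exists (a + b)%N; rewrite natrD; split=> //.
have fA : finite_set A by exists a.
have fB : finite_set B by exists b.
have -> : A `|` B = [set` fset_set (A `|` B)] by rewrite fset_setK // finite_setU.
apply/card_eq_fsetP; rewrite fset_setU // cardfsU -fset_setI // AB0 fset_set0.
by rewrite cardfs0 subn0 (card_fset_set cA) (card_fset_set cB).
Qed.

(** * Splitting lists of trees *)

Fixpoint leaves (t : bracketing) : nat :=
  if t is Prod l r then (leaves l + leaves r)%N else 1%N.

Lemma leaves_gt0 t : (0 < leaves t)%N.
Proof. by elim: t => //= l IHl r _; rewrite addn_gt0 IHl. Qed.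

(** Following right factors down from a product ends at a right multiplication by [Gen]. *)
Lemma right_mults_Prod_gt0 l r : (0 < right_mults (Prod l r))%N.
Proof.
elim: r l => [|l' _ r IHr] l; first by rewrite /= addn1.
change (0 < right_mults l + right_mults (Prod l' r) + 0)%N.
by rewrite addn0 addn_gt0 IHr orbT.
Qed.

Definition forests (j n k : nat) : set (seq bracketing) :=
  [set w | [/\ size w = j, sumn (map leaves w) = n &
               sumn (map right_mults w) = k]].

(** The default [Gen] of [head] excludes the empty list as well. *)
Definition prod_forests (j n k : nat) : set (seq bracketing) :=
  [set w | forests j n k w /\ ~~ is_gen (head Gen w)].

Lemma leq_size_leaves w : (size w <= sumn (map leaves w))%N.
Proof.
by elim: w => //= t w IHw; rewrite -add1n leq_add // leaves_gt0.
Qed.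

Definition mul_gen_head (w : seq bracketing) : seq bracketing :=
  if w is l :: w' then Prod l Gen :: w' else [::].

(* The right factor comes first, so that the inverse of [mul_head] pushes it on
   top of the left one. *)
Definition mul_head (w : seq bracketing) : seq bracketing :=
  if w is r :: l :: w' then Prod l r :: w' else [::].

Lemma forestsE j n k :
  forests j.+1 n.+1 k = cons Gen @` forests j n k `|` prod_forests j.+1 n.+1 k.
Proof.
apply/seteqP; split=> w.
  case: w => [|[|l r] w]; first by case.
    by case=> /= -[<-] [<-] <-; left; exists w.
  by right.
by case=> [[v [hs hn hk] <-]|[]//]; split; rewrite /= ?hs ?hn ?hk.
Qed.

(** Removing a right factor [Gen] loses one leaf and one right multiplication. Detaching a right
    factor that is a product preserves both totals and lengthens the list by one. *)
Lemma prod_forestsE j n k :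
  prod_forests j.+1 n.+1 k.+1 =
  mul_gen_head @` forests j.+1 n k `|` mul_head @` prod_forests j.+2 n.+1 k.+1.
Proof.
apply/seteqP; split=> w.
  case: w => [|[|l r] w] [] // [/= hs hn hk] _.
  case: r hn hk => [|rl rr] /= hn hk.
    left; exists (l :: w) => //; split=> //=; apply: succn_inj.
      by rewrite -hn; ring.
    by rewrite -hk; ring.
  right; exists (Prod rl rr :: l :: w) => //; split=> //; split=> /=.
  - by rewrite hs.
  - by rewrite -hn; ring.
  - by rewrite -hk; ring.
case=> [[[|l v] [//= hs hn hk] <-]|[[|[|rl rr] [|l v]] [] // [/= hs hn hk] _ <-]].
  split=> //; split=> //=; first by rewrite -hn; ring.
  by rewrite -hk; ring.
  by [].
split=> //; split=> /=.
- by case: hs => ->.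
- by rewrite -hn; ring.
- by rewrite -hk; ring.
Qed.

(** Each tree has at least one leaf, so [n] trees with [n] leaves in total are all [Gen]. *)
Lemma forests_diag n k : forests n n k = [set w | w = nseq n Gen /\ k = 0%N].
Proof.
apply/seteqP; split=> [w [hs hn hk]|w [-> ->]]; last first.
  by split; rewrite ?size_nseq ?map_nseq ?sumn_nseq //= mul1n.
suff ww : w = nseq n Gen.
  by split=> //; rewrite -hk ww map_nseq sumn_nseq mul0n.
elim: w n hs hn {hk} => [|[|l r] w IHw] n /= <- //.
  by move=> [hn]; congr cons; apply: IHw.
by have := leq_size_leaves w; have := leaves_gt0 l; have := leaves_gt0 r; lia.
Qed.

Lemma prod_forests_diag n k : prod_forests n n k = set0.
Proof.
apply/seteqP; split=> // w []; rewrite forests_diag => -[-> _].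
by case: n.
Qed.

Lemma prod_forests0 j n : prod_forests j n 0 = set0.
Proof.
apply/seteqP; split=> // -[|[|l r] w] [] //= [_ _] /=.
by have := right_mults_Prod_gt0 l r; rewrite /=; case: (_ + is_gen r)%N.
Qed.

Lemma forests0 n k : forests 0 n.+1 k = set0.
Proof. by apply/seteqP; split=> // -[|t w] []. Qed.

(** * The closed formula and its recurrence *)

(** The diagonal [j = n] is set apart: there the truncated [n - j - 1] is [0], and the general
    formula would give [n] at [k = 1] instead of [0]. *)
Definition num_forests (j n k : nat) : rat :=
  if j == n then (k == 0%N)%:R
  else j%:R / n%:R * 'C(n, k)%:R * (if k is k'.+1 then 'C(n - j - 1, k')%:R else 0).

Lemma mulrn_bin_left (R : comPzRingType) (n m : nat) :
  m.+1%:R * 'C(n, m.+1)%:R = (n%:R - m%:R) * 'C(n, m)%:R :> R.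
Proof.
rewrite -natrM mul_bin_left; case: (leqP m n) => [le_mn|lt_nm].
  by rewrite natrM natrB.
by rewrite bin_small // muln0 mulr0.
Qed.

Lemma mulrn_bin_diag (R : pzSemiRingType) (n m : nat) :
  m.+1%:R * 'C(n.+1, m.+1)%:R = n.+1%:R * 'C(n, m)%:R :> R.
Proof. by rewrite -!natrM -mul_bin_diag. Qed.

Lemma num_forests_diag n k : num_forests n n k = (k == 0%N)%:R.
Proof. by rewrite /num_forests eqxx. Qed.

Lemma num_forests_lt0 j n : (j < n)%N -> num_forests j n 0 = 0.
Proof. by rewrite /num_forests mulr0 => /ltn_eqF ->. Qed.

Lemma num_forests_ltS j n a k : n = (j + a.+1)%N ->
  num_forests j n k.+1 = j%:R / n%:R * 'C(n, k.+1)%:R * 'C(a, k)%:R.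
Proof.
move=> ->; rewrite /num_forests ltn_eqF; first by rewrite addKn subn1.
by rewrite -addSnnS leq_addr.
Qed.

(** The differences stand for the counts of lists whose first tree is a product; this is the second
    recurrence for them. *)
Lemma num_forests_rec j n k : (j < n)%N ->
  num_forests j.+1 n.+1 k.+1 - num_forests j n k.+1 =
  num_forests j.+1 n k + (num_forests j.+2 n.+1 k.+1 - num_forests j.+1 n k.+1).
Proof.
move=> /subnKC <-; move: (n - j.+1)%N => {n}[|a].
  (* For [n = j + 1] the whole right-hand side lies on the diagonal. *)
  rewrite addn0 !num_forests_diag /= !mulr0n subrr addr0.
  rewrite !(@num_forests_ltS _ _ 0) ?addn1 // bin0n.
  case: k => [|k]; rewrite ?mulr0 ?subr0 // !bin1 !mulr1 !divfK ?pnatr_eq0 //.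
  by rewrite -natrB ?subSnn.
have -> : (j.+1 + a.+1 = (j + a).+2)%N by rewrite addSnnS !addnS.
set n := (j + a)%N.
rewrite (@num_forests_ltS j.+1 n.+3 a.+1); last by rewrite /n; lia.
rewrite (@num_forests_ltS j n.+2 a.+1); last by rewrite /n; lia.
rewrite (@num_forests_ltS j.+2 n.+3 a); last by rewrite /n; lia.
rewrite (@num_forests_ltS j.+1 n.+2 a k); last by rewrite /n; lia.
case: k => [|k].
  rewrite num_forests_lt0 ?bin1 ?bin0 ?mulr1 ?divfK ?pnatr_eq0 //.
    by rewrite -!natr1; ring.
  by rewrite /n; lia.
rewrite (@num_forests_ltS j.+1 n.+2 a k); last by rewrite /n; lia.
(* All binomials are reduced to rational multiples of ['C(n.+2, k.+1)] and ['C(a, k)], which are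
   then generalized to leave an identity for [field]. *)
have Y : ('C(a, k.+1)%:R : rat) = (a%:R - k%:R) * 'C(a, k)%:R / k.+1%:R.
  by rewrite -mulrn_bin_left mulrAC mulfV ?mul1r ?pnatr_eq0.
have P : ('C(n.+2, k.+2)%:R : rat) = (n.+2%:R - k.+1%:R) * 'C(n.+2, k.+1)%:R / k.+2%:R.
  by rewrite -mulrn_bin_left mulrAC mulfV ?mul1r ?pnatr_eq0.
have Q : ('C(n.+3, k.+2)%:R : rat) = n.+3%:R * 'C(n.+2, k.+1)%:R / k.+2%:R.
  by rewrite -mulrn_bin_diag mulrAC mulfV ?mul1r ?pnatr_eq0.
rewrite (binS a) natrD P Q Y {P Q Y} /n.
move: ('C(_, _)%:R : rat) ('C(_, _)%:R : rat) => x y.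
rewrite -!natr1 !natrD.
field.
by rewrite -(natrD _ j a) !natr1 !pnatr_eq0.
Qed.

(** * Counting the lists *)

Lemma forests_prod_forests_disjoint j n k :
  cons Gen @` forests j n k `&` prod_forests j.+1 n.+1 k = set0.
Proof. by apply/seteqP; split=> // w [[v _ <-] []]. Qed.

Lemma mul_head_disjoint j n k :
  mul_gen_head @` forests j.+1 n k `&`
    mul_head @` prod_forests j.+2 n.+1 k.+1 = set0.
Proof.
apply/seteqP; split=> // w [[[|l v] [//= _ _ _] <-]].
by case=> -[|[|rl rr] [|l' v']] [] // _ _ [].
Qed.

Lemma mul_gen_head_inj j n k : {in forests j.+1 n k &, injective mul_gen_head}.
Proof.
by move=> [|l v] [|l' v']; rewrite !inE => -[//= _ _ _] [//= _ _ _] [-> ->].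
Qed.

Lemma mul_head_inj j n k : {in prod_forests j.+2 n k &, injective mul_head}.
Proof.
move=> [|r [|l v]] [|r' [|l' v']]; rewrite !inE.
all: by move=> [[//= _ _ _] _] [[//= _ _ _] _] [-> -> ->].
Qed.

(** The recurrence refers to longer lists with the same number of leaves, so the induction on
    [n - j] starts at [j = n], where no list contains a product. *)
Lemma card_prod_forests n :
  (forall j k, (j <= n)%N -> has_card (forests j n k) (num_forests j n k)) ->
  forall j k, (j <= n)%N -> has_card (prod_forests j.+1 n.+1 k)
    (num_forests j.+1 n.+1 k - num_forests j n k).
Proof.
move=> cardF j k le_jn; rewrite -(subKn le_jn).
elim: (n - j)%N (leq_subr j n) k => [_|d IHd lt_dn] k.
  by rewrite subn0 prod_forests_diag !num_forests_diag subrr; apply: has_card_set0.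
case: k => [|k].
  rewrite prod_forests0 !num_forests_lt0 ?subrr; [exact: has_card_set0|lia|lia].
have e : (n - d = (n - d.+1).+1)%N by lia.
have := IHd (ltnW lt_dn) k.+1; rewrite e => {}IHd.
rewrite prod_forestsE num_forests_rec; last by lia.
apply: has_card_setU; first exact: mul_head_disjoint.
  by apply: has_card_image; [exact: mul_gen_head_inj | apply: cardF; lia].
by apply: has_card_image; [exact: mul_head_inj | exact: IHd].
Qed.

Lemma card_forests j n k :
  (j <= n)%N -> has_card (forests j n k) (num_forests j n k).
Proof.
elim: n j k => [|n IHn] j k.
  rewrite leqn0 => /eqP ->; rewrite forests_diag num_forests_diag.
  case: k => [|k].
    rewrite (_ : mkset _ = [set [::]]); first exact: has_card_set1.
    by apply/seteqP; split=> w [].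
  rewrite (_ : mkset _ = set0) ?mulr0n; first exact: has_card_set0.
  by apply/seteqP; split=> w [].
case: j => [_|j le_jn].
  rewrite forests0 /num_forests /= !mul0r; exact: has_card_set0.
(* Adding and subtracting [num_forests j n k] matches the two classes of [forestsE]. *)
rewrite forestsE -[num_forests _ _ _](subrKC (num_forests j n k)).
apply: has_card_setU; first exact: forests_prod_forests_disjoint.
  by apply: has_card_image; [move=> v w _ _ [] | apply: IHn].
exact: card_prod_forests.
Qed.

(** * Transfer to the Catalan normed magma *)

Definition bracketing_magma : magma :=
  @MkMagma bracketing Prod (ex_intro _ Gen I) (countableP _).

Lemma free_irreducible_generator {M : magma} {Y : Type} {i : Y -> M} {u : M} :
  free_on i -> irreducible u -> exists y, i y = u.
Proof.
(* Otherwise [fun=> true] and [v |-> v <> u] are two morphisms to the magma of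
   booleans with constant product [true] that agree on the generators. *)
move=> free_i irr_u; apply: contrapT => no_y.
pose B := @MkMagma bool (fun _ _ => true) (ex_intro _ true I) (countableP _).
have [theta [_ uniq_theta]] := free_i B (fun=> true).
have theta1 : theta = (fun=> true) by apply: uniq_theta; split.
have theta2 : theta = (fun v => `[< v <> u >]).
  apply: uniq_theta; split.
    move=> v w; apply/asboolP => vw_u; apply: irr_u; exists v, w.
    by rewrite vw_u.
  apply/funext => y; apply/esym/asboolP => iy_u; apply: no_y; exists y.
  exact: iy_u.
have : theta u by rewrite theta1.
by rewrite theta2 => /asboolP.
Qed.

(** Freeness gives a morphism to [bracketing_magma] sending every generator to [Gen]. As [eps] is
    irreducible, it is a generator, so this morphism is a left inverse of [eval eps]. *)
Lemma eval_inj {F : magma} {norm : F -> nat} {eps : F}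
  (hF : catalan_normed_magma norm eps) :
  injective (eval eps).
Proof.
have [_ [Y [i free_i]] _ irr_eps _] := hF.
have [y iy] := free_irreducible_generator free_i (proj2 (irr_eps eps) erefl).
have [theta [[theta_mor theta_i] _]] := free_i bracketing_magma (fun=> Gen).
apply: (can_inj (g := theta)); elim=> /= [|l IHl r IHr].
  by rewrite -iy -[LHS]/((theta \o i) y) -theta_i.
by rewrite theta_mor IHl IHr.
Qed.

Lemma norm_eval {F : magma} {norm : F -> nat} {eps : F}
  (hF : catalan_normed_magma norm eps) (t : bracketing) :
  norm (eval eps t) = leaves t.
Proof.
have [_ _ norm_add _ norm_eps] := hF.
by elim: t => //= l <- r <-; rewrite norm_add.
Qed.

Lemma level_right_multsE {F : magma} {norm : F -> nat} {eps : F}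
  (hF : catalan_normed_magma norm eps) (n k : nat) :
  level_right_mults norm eps n k = (eval eps \o head Gen) @` forests 1 n k.
Proof.
apply/seteqP; split=> u.
  case=> norm_u [t [eval_t rm_t]]; exists [:: t] => //=.
  split; rewrite /= ?addn0 //.
  by rewrite -(norm_eval hF) eval_t.
case=> w [sw hn hk] <-; case: w sw hn hk => [|t [|]] //= _.
rewrite !addn0 => hn hk; split; last by exists t.
by rewrite /norm_level /= (norm_eval hF).
Qed.

Theorem proposition5 (F : magma) (norm : F -> nat) (eps : F)
  (hF : catalan_normed_magma norm eps) (n k : nat)
  (hk : (1 <= k <= n - 1)%N) :
  exists N : nat,
    level_right_mults norm eps n k #= `I_N /\
    N%:R = 1 / (n - 1)%N%:R * 'C(n - 1, k)%:R * 'C(n - 1, k - 1)%:R :> rat.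
Proof.
rewrite (level_right_multsE hF) //.
change (has_card ((eval eps \o head Gen) @` forests 1 n k)
  (1 / (n - 1)%N%:R * 'C(n - 1, k)%:R * 'C(n - 1, k - 1)%:R)).
case: k hk => [//|k] /= le_kn.
have [m n_eq] : exists m, n = m.+2 by exists (n - 2)%N; lia.
rewrite {}n_eq subn1 subSS subn0 /= in le_kn *.
apply: has_card_image.
  move=> v w; rewrite !inE => -[sv _ _] [sw _ _] /=.
  case: v w sv sw => [|t [|]] // [|t' [|]] //= _ _.
  by move=> /(eval_inj hF) ->.
suff <- : num_forests 1 m.+2 k.+1 =
    1 / m.+1%:R * 'C(m.+1, k.+1)%:R * 'C(m.+1, k)%:R by exact: card_forests.
rewrite (@num_forests_ltS 1 m.+2 m k) //.
(* Absorption turns both sides into ['C(m.+1, k) * 'C(m, k) / k.+1]. *)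
have absorb p q : 'C(p.+1, q.+1)%:R = p.+1%:R * 'C(p, q)%:R / q.+1%:R :> rat.
  by rewrite -mulrn_bin_diag mulrAC mulfV ?mul1r ?pnatr_eq0.
rewrite !absorb -!natr1; field.
by rewrite !natr1 !pnatr_eq0.
Qed.
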